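(* Consider the system $$\dot x_i = -\delta_i x_i + \pi\sum_{j=1}^n a^{(2)}_{ij}\psi_j(x_j) + \pi\sum_{j,k=1}^n a^{(3)}_{ijk}\psi_j(x_j)\psi_k(x_k),\qquad i=1,\dots,n,$$ and suppose that the functions $\psi_i$ satisfy (A.1)--(A.4) and that the matrices $A^{(3)}_i$ satisfy (i)--(ii) for all $i$ (conditions listed in the context). Let $\pi_1:=\dfrac{1}{\lambda_n(\Delta^{-1}A^{(2)})}$. Then the origin is an equilibrium point of the system for all $\pi>0$. Moreover, the origin is locally asymptotically stable if $\pi\in(0,\pi_1)$, and unstable if $\pi>\pi_1$.
   Context: Setting. $n\ge 2$ agents with opinions $x=(x_1,\dots,x_n)\in\mathbb{R}^n$; $\pi>0$ is a scalar parameter. $A^{(2)}=[a^{(2)}_{ij}]\in\mathbb{R}^{n\times n}$ is entrywise nonnegative, symmetric, irreducible, with zero diagonal. $A^{(3)}=(a^{(3)}_{ijk})$ is an entrywise nonnegative $n\times n\times n$ tensor; for each $i$, $A^{(3)}_i:=[a^{(3)}_{ijk}]_{j,k=1}^n\in\mathbb{R}^{n\times n}$. The degrees are $\delta_i=\sum_j a^{(2)}_{ij}+\sum_{j,k}a^{(3)}_{ijk}>0$ and $\Delta=\mathrm{diag}(\delta_1,\dots,\delta_n)$. The eigenvalues of $\Delta^{-1}A^{(2)}$ are real (the matrix is diagonally symmetrizable) and ordered $\lambda_1\le\dots\le\lambda_n$. Conditions on the differentiable functions $\psi_i:\mathbb{R}\to\mathbb{R}$: (A.1) $\psi_i(-s)=-\psi_i(s)$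 for all $s$; (A.2) $\psi_i'(s)>0$ for all $s$ and $\psi_i'(0)=1$; (A.3) $\lim_{s\to\pm\infty}\psi_i(s)=\pm1$; (A.4) $\psi_i$ is strictly convex for $s<0$ and strictly concave for $s>0$. Conditions on $A^{(3)}_i$: (i) $A^{(3)}_i=(A^{(3)}_i)^T$; (ii) $[A^{(3)}_i]_{ij}=[A^{(3)}_i]_{ji}=0$ for all $j$. *)

(* Defs.v *)
From HB Require Import structures.
From mathcomp Require Import all_boot all_order all_algebra all_fingroup.
From mathcomp Require Import all_classical all_reals all_analysis.

Set Implicit Arguments.
Unset Strict Implicit.
Unset Printing Implicit Defensive.

Import Order.TTheory GRing.Theory Num.Theory.
Import numFieldNormedType.Exports.

Local Open Scope classical_set_scope.
Local Open Scope ring_scope.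

(* A is reducible when P A P^T is block upper triangular, with square diagonal
   blocks of sizes r and n - r, for some permutation matrix P and 0 < r < n. *)
Definition reducible (R : realType) (n : nat) (A : 'M[R]_n) : Prop :=
  exists (s : 'S_n) (r : nat), (0 < r < n)%N /\
    forall i j : 'I_n, (r <= i)%N -> (j < r)%N -> A (s i) (s j) = 0.

Definition irreducible_mx (R : realType) (n : nat) (A : 'M[R]_n) : Prop :=
  ~ reducible A.

(* Largest real eigenvalue. The set is finite, so sup is a maximum as soon as
   there is an eigenvalue. MathComp's eigenvalue uses row eigenvectors, which
   gives the same eigenvalues as column eigenvectors. *)
Definition lambda_max (R : realType) (n : nat) (A : 'M[R]_n) : R :=
  sup [set a : R | eigenvalue A a].

Lemma lambda_maxE (R : realType) (n : nat) (A : 'M[R]_n.+1)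
    (lam : 'I_n.+1 -> R) :
  {homo lam : i j / (i <= j)%N >-> i <= j} ->
  char_poly A = \prod_(i < n.+1) ('X - (lam i)%:P) ->
  lambda_max A = lam ord_max.
Proof.
move=> lam_ndecr charA.
have eigE a : eigenvalue A a <-> exists i, a = lam i.
  rewrite eigenvalue_root_char charA rootE horner_prod; split.
    by move=> /prodf_eq0[i _]; rewrite hornerXsubC subr_eq0 => /eqP ->; exists i.
  move=> [i ->]; apply/prodf_eq0; exists i => //.
  by rewrite hornerXsubC subrr.
have ub : ubound [set a | eigenvalue A a] (lam ord_max).
  by move=> a /eigE[i ->]; apply: lam_ndecr; rewrite -ltnS.
have mem : [set a | eigenvalue A a] (lam ord_max) by apply/eigE; exists ord_max.
apply/eqP; rewrite eq_le; apply/andP; split.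
  by apply: ge_sup => //; exists (lam ord_max).
by apply: ub_le_sup => //; exists (lam ord_max).
Qed.

Definition strictly_convex_on (R : realType) (D : set R) (f : R -> R) : Prop :=
  forall x y t : R, D x -> D y -> x != y -> 0 < t -> t < 1 ->
    f (t * x + (1 - t) * y) < t * f x + (1 - t) * f y.

Definition strictly_concave_on (R : realType) (D : set R) (f : R -> R) : Prop :=
  forall x y t : R, D x -> D y -> x != y -> 0 < t -> t < 1 ->
    t * f x + (1 - t) * f y < f (t * x + (1 - t) * y).

Section Dynamics.
Variables (R : realType) (n : nat).

(* Forward solution of x' = F(x) on [0, +oo); the values at negative times are
   irrelevant. For continuous F the right derivative at 0 exists as well. *)
Definition solution (F : 'rV[R]_n -> 'rV[R]_n) (x : R -> 'rV[R]_n) : Prop :=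
  {within [set t : R | 0 <= t], continuous x} /\
  forall t : R, 0 < t -> is_derive t (1 : R) x (F (x t)).

Definition equilibrium (F : 'rV[R]_n -> 'rV[R]_n) (xs : 'rV[R]_n) : Prop :=
  F xs = 0.

(* `| . | is the sup norm on 'rV[R]_n. Stability only involves solutions
   defined for all t >= 0, which is no restriction for a globally Lipschitz
   field such as opinion_field below when each psi i satisfies
   sigmoid (then 0 < psi_i' <= 1 and |psi_i| < 1). *)
Definition lyapunov_stable (F : 'rV[R]_n -> 'rV[R]_n) (xs : 'rV[R]_n) : Prop :=
  forall e : R, 0 < e -> exists d : R, 0 < d /\
    forall x : R -> 'rV[R]_n, solution F x -> `|x 0 - xs| < d ->
      forall t : R, 0 <= t -> `|x t - xs| < e.

(* The existence clause rules out attractivity for lack of solutions. *)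
Definition attractive (F : 'rV[R]_n -> 'rV[R]_n) (xs : 'rV[R]_n) : Prop :=
  exists d : R, 0 < d /\
    forall x0 : 'rV[R]_n, `|x0 - xs| < d ->
      (exists x : R -> 'rV[R]_n, solution F x /\ x 0 = x0) /\
      (forall x : R -> 'rV[R]_n, solution F x -> x 0 = x0 ->
         x t @[t --> +oo] --> xs).

Definition locally_asymptotically_stable
    (F : 'rV[R]_n -> 'rV[R]_n) (xs : 'rV[R]_n) : Prop :=
  lyapunov_stable F xs /\ attractive F xs.

Definition unstable (F : 'rV[R]_n -> 'rV[R]_n) (xs : 'rV[R]_n) : Prop :=
  ~ lyapunov_stable F xs.

Definition degree (A2 : 'M[R]_n) (A3 : 'I_n -> 'M[R]_n) (i : 'I_n) : R :=
  \sum_j A2 i j + \sum_j \sum_k A3 i j k.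

Definition degree_mx (A2 : 'M[R]_n) (A3 : 'I_n -> 'M[R]_n) : 'M[R]_n :=
  diag_mx (\row_i degree A2 A3 i).

(* p is the scalar parameter usually written pi. *)
Definition opinion_field (A2 : 'M[R]_n) (A3 : 'I_n -> 'M[R]_n)
    (psi : 'I_n -> R -> R) (p : R) (x : 'rV[R]_n) : 'rV[R]_n :=
  \row_i (- degree A2 A3 i * x 0 i
          + p * (\sum_j A2 i j * psi j (x 0 j))
          + p * (\sum_j \sum_k A3 i j k * psi j (x 0 j) * psi k (x 0 k))).

Definition threshold (A2 : 'M[R]_n) (A3 : 'I_n -> 'M[R]_n) : R :=
  1 / lambda_max (invmx (degree_mx A2 A3) *m A2).

End Dynamics.


Record sigmoid (R : realType) (f : R -> R) : Prop := Sigmoid {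
  sigmoid_derivable : forall s : R, derivable f s (1 : R);
  sigmoid_odd : forall s : R, f (- s) = - f s;
  sigmoid_derive_gt0 : forall s : R, 0 < derive1 f s;
  sigmoid_derive0 : derive1 f 0 = 1;
  sigmoid_pinfty : f s @[s --> +oo] --> (1 : R);
  sigmoid_ninfty : f s @[s --> -oo] --> (- 1 : R);
  sigmoid_convex : strictly_convex_on [set s : R | s < 0] f;
  sigmoid_concave : strictly_concave_on [set s : R | 0 < s] f
}.

(* Main.v *)
Require Import Defs.
From mathcomp Require Import all_boot all_order all_algebra all_fingroup.
From mathcomp Require Import all_classical all_reals all_analysis.
From mathcomp Require Import ring lra.
Set Implicit Arguments.
Unset Strict Implicit.
Unset Printing Implicit Defensive.

Import Order.TTheory GRing.Theory Num.Theory.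
Import numFieldNormedType.Exports.
Local Open Scope classical_set_scope.
Local Open Scope ring_scope.

(** The field is [F x = x M + o(x)] at the origin, with the symmetric matrix
    [M = p A2 - D], where [D] is the diagonal matrix of degrees.  Let [lam] be
    the largest eigenvalue of [D^-1 A2]; then [x A2 x^T <= lam x D x^T] with
    equality at an eigenvector.
    If [p lam < 1], then [x M x^T <= - c |x|^2] and [|x|^2] is a strict Lyapunov
    function near [0].
    If [p lam > 1], then [M] has a positive direction; for a small [e > 0] that
    is not an eigenvalue of [M], [V = x (M - e) x^T] satisfies [V' >= 2 e V] in a
    ball, so a solution starting at a small point with [V > 0] leaves that ball.
    Solutions are global, hence within the scope of [lyapunov_stable], because
    concavity makes each [psi i] Lipschitz; they come from Picard iteration with
    the weight [exp(2 L t)], which makes it contract by a factor of 2. *)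

(** * One-variable calculus *)

(** Mean value theorem. Continuity is taken within the half-line and differentiability on the open
    interval only, since a [solution] offers no more at time 0. *)
Lemma derive_le0_nonincr (R : realType) (f df : R -> R) (a b : R) :
  0 <= a -> a <= b -> {within [set t : R | 0 <= t], continuous f} ->
  (forall t : R, a < t -> t < b -> is_derive t 1 f (df t)) ->
  (forall t : R, a < t -> t < b -> df t <= 0) -> f b <= f a.
Proof.
move=> a0; rewrite le_eqVlt => /predU1P[->//|ab] cf dfE df0.
have cab : {within `[a, b], continuous f}.
  apply: continuous_subspaceW cf => t /=; rewrite in_itv/= => /andP[at_ _].
  exact: le_trans at_.
have fab t : t \in `]a, b[ -> is_derive t 1 f (df t).
  by rewrite in_itv/= => /andP[]; exact: dfE.
have [c + cE] := MVT ab fab cab.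
rewrite in_itv/= => /andP[ac cb].
by rewrite -subr_le0 cE mulr_le0_ge0 ?df0// subr_ge0 ltW.
Qed.

(* At the first time [T] where [V T >= rho], [V] has been nonincreasing
   on [[0, T]], so [V T <= V 0 < rho]. *)
Lemma trapping (R : realType) (V dV : R -> R) (rho : R) :
  {within [set t : R | 0 <= t], continuous V} ->
  (forall t : R, 0 < t -> is_derive t 1 V (dV t)) ->
  (forall t : R, 0 < t -> V t < rho -> dV t <= 0) ->
  V 0 < rho -> forall t : R, 0 <= t -> V t < rho.
Proof.
move=> cV dVE dV0 V0 t t0; rewrite ltNge; apply/negP => Vt.
pose S := [set s : R | 0 <= s /\ rho <= V s].
have St : S t by [].
have lbS : lbound S 0 by move=> s [].
have hS : has_inf S by split; [exists t|exists 0].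
pose T := inf S.
have T0 : 0 <= T by apply: lb_le_inf => //; exists t.
have ltT s : 0 <= s -> s < T -> V s < rho.
  move=> s0 sT; rewrite ltNge; apply/negP => Vs.
  by move: sT; rewrite ltNge => /negP; apply; apply: ge_inf; [exists 0|].
have VT : V T <= V 0.
  apply: (@derive_le0_nonincr _ V dV) => // s s0 sT; first exact: dVE.
  by apply: dV0 => //; apply: ltT => //; exact: ltW.
have VTr : V T < rho by exact: le_lt_trans V0.
(* Continuity spreads [V T < rho] to a neighborhood of [T], yet [S] has points arbitrarily close to
   its infimum [T]. *)
have : \forall s \near within [set t : R | 0 <= t] (nbhs T), V s < rho.
  have /subspace_continuousP /(_ T T0) := cV.
  move=> /cvgr_lt; exact.
rewrite /within/= => /nbhs_ballP[e /= e0 eV].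
have [s [s0 Vs] sT] := inf_adherent e0 hS.
have Ts : T <= s by apply: ge_inf; [exists 0|].
have : V s < rho.
  apply: eV => //=; rewrite /ball/= distrC ger0_norm ?subr_ge0//.
  by rewrite ltrBlDl.
by rewrite ltNge Vs.
Qed.

Lemma antiderivative (R : realType) (g : R -> R) : continuous g ->
  exists G : R -> R, [/\ continuous G, G 0 = 0 &
    forall t : R, 0 < t -> is_derive t 1 G (g t)].
Proof.
move=> cg; pose mu := @lebesgue_measure R.
(* Integrating from -1 makes [F] differentiable, hence continuous, at 0 as well. *)
pose F (x : R) : R := (\int[mu]_(t in [set` Interval (BLeft (-1 : R)) (BRight x)]) g t)%R.
have dF (x : R) : -1 < x -> is_derive x 1 F (g x).
  move=> x1; have [||||dFx Fx] := @continuous_FTC1 R g (BLeft (-1)) x (x + 1).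
  - by rewrite ltrDl.
  - apply: continuous_compact_integrable; first exact: segment_compact.
    exact: continuous_subspaceT.
  - by rewrite lte_fin.
  - exact: cg.
  by apply: (DeriveDef dFx); rewrite -derive1E; exact: Fx.
(* The absolute value gives continuity on the whole line; values at negative times do not matter. *)
exists (fun t => F `|t| - F 0); split.
- move=> t; apply: cvgB; last exact: cvg_cst.
  apply: (@continuous_comp _ _ _ (fun t : R => `|t|) F); first exact: norm_continuous.
  apply: differentiable_continuous; apply/derivable1_diffP.
  by have [] := dF `|t|; first by rewrite (lt_le_trans _ (normr_ge0 t)) ?ltrN10.
- by rewrite normr0 subrr.
- move=> t t0.
  have tN1 : -1 < t by rewrite (lt_trans _ t0) ?ltrN10.
  apply: (@near_eq_is_derive _ _ _ (F - cst (F 0))).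
  + near=> s; rewrite /= ger0_norm//; near: s.
    by apply: filterS (lt_nbhsr t0) => s; exact: ltW.
  + by have := dF t tN1 => dFt; rewrite -[g t]subr0; apply: is_deriveB.
Unshelve. all: by end_near. Qed.

(** * Global solutions of Lipschitz fields *)

Lemma coord_norm_le (R : realType) (n : nat) (x : 'rV[R]_n) (i : 'I_n) :
  `|x 0 i| <= `|x|.
Proof.
rewrite [leRHS]/Num.Def.normr/= mx_normrE.
exact: (le_bigmax _ (fun ij : 'I_1 * 'I_n => `|x ij.1 ij.2|) (0, i)).
Qed.

Lemma norm_row_le (R : realType) (n : nat) (x : 'rV[R]_n) (e : R) :
  0 <= e -> (forall i, `|x 0 i| <= e) -> `|x| <= e.
Proof.
move=> e0 xe; rewrite [leLHS]/Num.Def.normr/= mx_normrE.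
by apply: bigmax_le => // -[i j] _ /=; rewrite ord1.
Qed.

Lemma is_derive_rowP (R : realType) (n : nat) (x : R -> 'rV[R]_n)
    (y : 'rV[R]_n) (t : R) :
  is_derive t 1 x y <-> forall i, is_derive t 1 (fun s => x s 0 i) (y 0 i).
Proof.
split=> [[dx xy] i|dx].
  have dxi := (derivable_mxP _ _ _).1 dx 0 i.
  by apply: (DeriveDef dxi); rewrite -xy derive_mx// mxE.
have dX : derivable x t 1.
  by apply/derivable_mxP => i j; rewrite ord1; have [] := dx j.
apply: (DeriveDef dX); apply/rowP => i.
by rewrite derive_mx// mxE; have [] := dx i.
Qed.

Lemma continuous_row (R : realType) (n : nat) (x : R -> 'rV[R]_n) :
  (forall i, continuous (fun t => x t 0 i)) -> continuous x.
Proof.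
move=> cx t; apply/cvgrPdist_le => e e0.
near=> s; apply: norm_row_le => [|i]; first exact: ltW.
rewrite !mxE; move: i; near: s; apply: filter_forall => i.
exact: (cvgrPdist_le _ _).1 (cx i t) e e0.
Unshelve. all: by end_near. Qed.

Lemma continuous_coord (R : realType) (n : nat) (T : topologicalType)
    (u : T -> 'rV[R]_n) (i : 'I_n) :
  continuous u -> continuous (fun t => u t 0 i).
Proof.
move=> cu t; apply: (@continuous_comp _ _ _ u (fun v : 'rV[R]_n => v 0 i)).
  exact: cu.
exact: coord_continuous.
Qed.

Lemma antiderivative_row (R : realType) (n : nat) (g : R -> 'rV[R]_n)
    (x0 : 'rV[R]_n) : continuous g ->
  exists G : R -> 'rV[R]_n, [/\ continuous G, G 0 = x0 &
    forall t : R, 0 < t -> is_derive t 1 G (g t)].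
Proof.
move=> cg.
have cgi i : continuous (fun t => g t 0 i) by exact: continuous_coord.
have [G HG] := choice (fun i => antiderivative (cgi i)).
exists (fun t => x0 + \row_i G i t); split.
- apply: continuous_row => i.
  rewrite (_ : (fun t => _) = (fun t => x0 0 i + G i t)); last first.
    by apply/funext => t; rewrite !mxE.
  move=> t; apply: cvgD; first exact: cvg_cst.
  by have [+ _ _] := HG i; apply.
- by apply/rowP => i; rewrite !mxE; have [_ -> _] := HG i; rewrite addr0.
- move=> t t0; apply/is_derive_rowP => i.
  rewrite (_ : (fun t => _) = cst (x0 0 i) + G i); last first.
    by apply/funext => s; rewrite !mxE.
  rewrite -[g t 0 i]add0r; apply: is_deriveD.
  by have [_ _] := HG i; apply.
Qed.

Lemma is_derive_expRM (R : realType) (m t : R) :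
  is_derive t 1 (fun s => expR (m * s)) (m * expR (m * t)).
Proof.
have H : is_derive t 1 (fun s : R => m * s) m.
  by rewrite -[X in is_derive _ _ _ X](mulr1 m); apply: (@is_deriveZ _ _ _ id).
have := @is_derive1_comp R expR (fun s => m * s) t _ _ _ H.
move=> /(_ _ (is_derive_expR _)).
by rewrite [X in is_derive _ _ _ X -> _]mulrC.
Qed.

(** [u t - k / m * expR (m * t)] is nonincreasing and starts at [- k / m <= 0]. The division by [m]
    is what makes Picard iteration contract. *)
Lemma expR_growth (R : realType) (u f : R -> R) (m k : R) :
  0 < m -> 0 <= k -> continuous u -> u 0 = 0 ->
  (forall t : R, 0 < t -> is_derive t 1 u (f t)) ->
  (forall t : R, 0 < t -> f t <= k * expR (m * t)) ->
  forall t : R, 0 <= t -> u t <= k / m * expR (m * t).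
Proof.
move=> m0 k0 cu u0 du fk t t0.
have ds (s : R) : is_derive s 1 (fun s => k / m * expR (m * s)) (k * expR (m * s)).
  have := is_deriveZ (k / m) (is_derive_expRM m s).
  by rewrite /GRing.scale/= mulrA divfK// gt_eqF.
have cs : continuous (fun s => k / m * expR (m * s)).
  move=> s; apply: differentiable_continuous; apply/derivable1_diffP.
  by have [] := ds s.
have := @derive_le0_nonincr R (fun s => u s - k / m * expR (m * s))
  (fun s => f s - k * expR (m * s)) 0 t (lexx _) t0.
rewrite mulr0 expR0 u0 sub0r mulr1 => H.
rewrite -subr_le0 (le_trans (H _ _ _))//.
- by apply: continuous_subspaceT => s; apply: cvgB; [exact: cu|exact: cs].
- by move=> s s0 _; apply: is_deriveB; exact: du.
- by move=> s s0 _; rewrite subr_le0 fk.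
- by rewrite oppr_le0 divr_ge0// ltW.
Qed.

Lemma expR_growth_row (R : realType) (n : nat) (z f : R -> 'rV[R]_n) (m k : R) :
  0 < m -> 0 <= k -> continuous z -> z 0 = 0 ->
  (forall t : R, 0 < t -> is_derive t 1 z (f t)) ->
  (forall t : R, 0 < t -> `|f t| <= k * expR (m * t)) ->
  forall t : R, 0 <= t -> `|z t| <= k / m * expR (m * t).
Proof.
move=> m0 k0 cz z0 dz fk t t0.
have km0 : 0 <= k / m by rewrite divr_ge0// ltW.
apply: norm_row_le => [|i]; first by rewrite mulr_ge0 ?expR_ge0.
have czi : continuous (fun t => z t 0 i) by exact: continuous_coord.
have dzi (s : R) : 0 < s -> is_derive s 1 (fun t => z t 0 i) (f s 0 i).
  by move=> /dz/is_derive_rowP.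
have fki (s : R) : 0 < s -> `|f s 0 i| <= k * expR (m * s).
  by move=> s0; rewrite (le_trans (coord_norm_le _ _))// fk.
rewrite ler_norml lerNl; apply/andP; split.
  apply: (@expR_growth R (fun s => - z s 0 i) (fun s => - f s 0 i)) => //.
  - by move=> s; apply: cvgN; exact: czi.
  - by rewrite z0 mxE oppr0.
  - by move=> s s0; apply: is_deriveN; exact: dzi.
  - by move=> s s0; rewrite (le_trans (ler_norm _))// normrN fki.
apply: (@expR_growth R (fun s => z s 0 i) (fun s => f s 0 i)) => //.
- by rewrite z0 mxE.
- by move=> s s0; rewrite (le_trans (ler_norm _))// fki.
Qed.

(* [a k - 2 c / 2 ^ k] is nondecreasing and bounded above by every
   [a j + 2 c / 2 ^ j]; its supremum is the limit. *)
Lemma geometric_cauchy (R : realType) (a : nat -> R) (c : R) :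
  (forall k, `|a k.+1 - a k| <= c / 2 ^+ k) ->
  exists l, forall k, `|l - a k| <= 2 * c / 2 ^+ k.
Proof.
move=> ac; pose b k := 2 * c / 2 ^+ k.
have c0 : 0 <= c by have := ac 0%N; rewrite expr0 divr1; apply: le_trans.
have b0 k : 0 <= b k by rewrite divr_ge0 ?mulr_ge0 ?exprn_ge0.
have bS k : b k = c / 2 ^+ k + b k.+1.
  by rewrite /b exprS; field; rewrite expf_neq0.
have lo k d : a k - b k <= a (k + d)%N - b (k + d)%N.
  elim: d => [|d IH]; first by rewrite addn0.
  rewrite (le_trans IH)// addnS (bS (k + d)%N).
  by have := ac (k + d)%N; rewrite ler_norml => /andP[+ _]; lra.
have hi k d : a (k + d)%N + b (k + d)%N <= a k + b k.
  elim: d => [|d IH]; first by rewrite addn0.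
  rewrite (le_trans _ IH)// addnS (bS (k + d)%N).
  by have := ac (k + d)%N; rewrite ler_norml => /andP[_]; lra.
have lohi j k : a j - b j <= a k + b k.
  have := lo j (maxn j k - j)%N; have := hi k (maxn j k - k)%N.
  rewrite !subnKC ?leq_maxl ?leq_maxr//.
  by have := b0 (maxn j k); lra.
exists (sup (range (fun k => a k - b k))) => k.
have hub : has_ubound (range (fun k => a k - b k)).
  by exists (a 0%N + b 0%N) => _ [j _ <-].
rewrite ler_distl; apply/andP; split.
  by apply: ub_le_sup => //; exists k.
apply: ge_sup; first by exists (a 0%N - b 0%N); exists 0%N.
by move=> _ [j _ <-].
Qed.

Lemma lipschitz_continuous (R : realType) (V W : normedModType R) (f : V -> W)
    (L : R) :
  0 < L -> (forall x y, `|f x - f y| <= L * `|x - y|) -> continuous f.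
Proof.
move=> L0 fL x; apply/cvgrPdist_le => e e0; apply/nbhs_normP.
exists (e / L) => /= [|y /= xy]; first by rewrite divr_gt0.
by rewrite (le_trans (fL _ _))// mulrC -ler_pdivlMr// ltW.
Qed.

Lemma continuous_comp_normr (R : realType) (V : normedModType R) (f : R -> V) :
  continuous f -> continuous (fun t : R => f `|t|).
Proof.
move=> cf t; apply: (@continuous_comp _ _ _ (fun t : R => `|t|) f).
  exact: norm_continuous.
exact: cf.
Qed.

(** The e/3 argument. The approximant may depend on [t] and [e], as Picard iterates converge
    uniformly on bounded time intervals only. *)
Lemma locally_uniform_limit_continuous (R : realType) (V : normedModType R)
    (f : R -> V) :
  (forall (t e : R), 0 < e -> exists2 g : R -> V, continuous g &
    \forall s \near t, `|f s - g s| <= e) ->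
  continuous f.
Proof.
move=> fg t; apply/cvgrPdist_le => e e0.
have e30 : 0 < e / 3 by rewrite divr_gt0.
have [g cg fge] := fg t _ e30.
have fgt : `|f t - g t| <= e / 3 by exact: nbhs_singleton fge.
near=> s.
rewrite (_ : f t - f s = (f t - g t) + (g t - g s) + - (f s - g s)); last first.
  by rewrite opprB !subrKA.
rewrite (_ : e = e / 3 + e / 3 + e / 3); last by field.
rewrite (le_trans (ler_normD _ _))// lerD//; last first.
  by rewrite normrN; near: s.
rewrite (le_trans (ler_normD _ _))// lerD//.
near: s; exact: (cvgrPdist_le _ _).1 (cg t) _ e30.
Unshelve. all: by end_near. Qed.

Lemma lipschitz_solution (R : realType) (n : nat) (F : 'rV[R]_n -> 'rV[R]_n)
    (L : R) (x0 : 'rV[R]_n) :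
  0 < L -> (forall x y, `|F x - F y| <= L * `|x - y|) ->
  exists x, solution F x /\ x 0 = x0.
Proof.
move=> L0 FL.
have cF : continuous F by exact: lipschitz_continuous L0 FL.
(* [Phi x] is the Picard operator, [x0] plus the integral of [F (x s)] over [0, t] for t >= 0; it is
   unconstrained at discontinuous [x]. *)
have [Phi PhiP] : exists Phi : (R -> 'rV[R]_n) -> R -> 'rV[R]_n,
    forall x, continuous x -> [/\ continuous (Phi x), Phi x 0 = x0 &
      forall t : R, 0 < t -> is_derive t 1 (Phi x) (F (x t))].
  suff /choice[Phi PhiP] : forall x, exists z : R -> 'rV[R]_n, continuous x ->
      [/\ continuous z, z 0 = x0 &
        forall t : R, 0 < t -> is_derive t 1 z (F (x t))] by exists Phi.
  move=> x; have [cx|] := pselect (continuous x); last by exists x.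
  have cFx : continuous (F \o x).
    by move=> t; apply: continuous_comp; [exact: cx|exact: cF].
  by have [z zP] := antiderivative_row x0 cFx; exists z.
pose X k := iter k Phi (cst x0).
have cX k : continuous (X k).
  elim: k => [|k IH]; first by move=> t; exact: cvg_cst.
  by have [] := PhiP _ IH.
have X0 k : X k 0 = x0.
  by case: k => // k; have [] := PhiP _ (cX k).
have dX k (t : R) : 0 < t -> is_derive t 1 (X k.+1) (F (X k t)).
  by have [_ _] := PhiP _ (cX k); apply.
pose E t := expR (2 * L * t).
have E0 t : 0 <= E t by exact: expR_ge0.
have L20 : 0 < 2 * L by rewrite mulr_gt0.
pose C := `|F x0| / (2 * L).
have C0 : 0 <= C by rewrite divr_ge0// ltW.
(* [Phi] halves distances weighted by [E]: the Lipschitz bound costs a factor [L], and integrating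
   [E] gains [2 * L]. *)
have bnd (u v : R -> 'rV[R]_n) (c : R) : continuous u -> continuous v ->
    0 <= c -> (forall t : R, 0 <= t -> `|u t - v t| <= c * E t) ->
    forall t : R, 0 <= t -> `|Phi u t - Phi v t| <= c / 2 * E t.
  move=> cu cv c0 uv t t0.
  have [cPu Pu0 dPu] := PhiP _ cu; have [cPv Pv0 dPv] := PhiP _ cv.
  rewrite (_ : c / 2 = (L * c) / (2 * L)); last by field; rewrite gt_eqF.
  apply: (@expR_growth_row R n (fun s => Phi u s - Phi v s)
    (fun s => F (u s) - F (v s))) => //.
  - by rewrite mulr_ge0// ltW.
  - by move=> s; apply: cvgB; [exact: cPu|exact: cPv].
  - by rewrite Pu0 Pv0 subrr.
  - by move=> s s0; apply: is_deriveB; [exact: dPu|exact: dPv].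
  - move=> s s0; rewrite (le_trans (FL _ _))// -mulrA ler_pM2l//.
    exact/uv/ltW.
have XC k : forall t : R, 0 <= t -> `|X k.+1 t - X k t| <= C * E t / 2 ^+ k.
  elim: k => [|k IH] t t0.
    rewrite expr0 divr1.
    apply: (@expR_growth_row R n (fun s => X 1%N s - x0) (fun s => F x0 - 0)) => //.
    - by move=> s; apply: cvgB; [exact: cX|exact: cvg_cst].
    - by rewrite X0 subrr.
    - by move=> s s0; apply: is_deriveB; exact: (dX 0%N).
    - move=> s s0; rewrite subr0 ler_peMr// -[leLHS]expR0 ler_expR.
      by rewrite mulr_ge0 ?ltW ?mulr_gt0.
  rewrite (_ : _ / _ = C / 2 ^+ k / 2 * E t); last first.
    by rewrite exprS; field; rewrite expf_neq0.
  apply: (bnd (X k.+1) (X k) (C / 2 ^+ k) (cX _) (cX _)) => //.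
    by rewrite divr_ge0// exprn_ge0.
  by move=> s s0; rewrite (le_trans (IH s s0))// mulrAC.
(* The limit is built coordinate by coordinate, and at [|t|] because the estimates hold for
   nonnegative times. *)
have /choice[Y XY] : forall t : R, exists y, forall k,
    `|y - X k `|t| | <= 2 * (C * E `|t|) / 2 ^+ k.
  move=> t.
  have /choice[y yP] : forall i, exists l, forall k,
      `|l - X k `|t| 0 i| <= 2 * (C * E `|t|) / 2 ^+ k.
    move=> i; apply: geometric_cauchy => k.
    have := le_trans (coord_norm_le _ i) (XC k `|t| (normr_ge0 t)).
    by rewrite !mxE.
  exists (\row_i y i) => k; apply: norm_row_le => [|i]; last by rewrite !mxE.
  by apply: divr_ge0; [apply: mulr_ge0 => //; exact: mulr_ge0|exact: exprn_ge0].
have small (c e : R) : 0 < e -> exists k, c / 2 ^+ k < e.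
  move=> e0; have : (c / 2 ^+ k) @[k --> \oo] --> (0 : R).
    rewrite (_ : (fun _ => _) = geometric c 2^-1); last first.
      by apply/funext => k; rewrite /= exprVn.
    by apply: cvg_geometric; rewrite ger0_norm; lra.
  move=> /cvgr_lt /(_ e e0) [k _ kP]; exists k; exact/kP/leqnn.
have cY : continuous Y.
  apply: locally_uniform_limit_continuous => t e e0.
  pose T := `|t| + 1.
  have [k kP] := small (2 * (C * E T)) e e0.
  exists (fun s => X k `|s|); first exact: continuous_comp_normr (cX k).
  have : \forall s \near t, `|s : R| <= T.
    by apply: (cvgr_le _ (@norm_continuous R R^o t)) => //; rewrite ltrDl.
  apply: filterS => s sT; rewrite (le_trans (XY s k))// (le_trans _ (ltW kP))//.
  rewrite ler_pM2r ?invr_gt0 ?exprn_gt0// ler_pM2l// ler_wpM2l//.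
  by rewrite ler_expR ler_pM2l.
have [cZ Z0 dZ] := PhiP _ cY.
(* The derivative of [Phi Y] is known to be [F (Y t)], so it remains to see that [Y] is a fixed
   point at positive times. *)
exists (Phi Y); split => //.
split; first exact: continuous_subspaceT.
move=> t t0.
suff <- : Y t = Phi Y t by exact: dZ.
apply/eqP; rewrite -subr_eq0 -normr_le0 leNgt; apply/negP => YZ.
(* Both [Y t] and [Phi Y t] lie within [C * E t / 2 ^+ k] of [X k.+1 t], for every [k]. *)
have [k] := small (3 * (C * E t)) _ YZ.
apply/negP; rewrite -leNgt.
have Yk (s : R) : 0 <= s -> `|Y s - X k s| <= 2 * C / 2 ^+ k * E s.
  by move=> s0; have := XY s k; rewrite (ger0_norm s0) mulrA mulrAC.
have ZX : `|Phi Y t - X k.+1 t| <= C / 2 ^+ k * E t.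
  have := bnd Y (X k) _ cY (cX k) _ Yk t (ltW t0).
  rewrite (_ : 2 * C / 2 ^+ k / 2 = C / 2 ^+ k); last first.
    by field; rewrite expf_neq0.
  by apply; apply: divr_ge0; [exact: mulr_ge0|exact: exprn_ge0].
have YX := XY t k.+1; rewrite ger0_norm ?(ltW t0)// in YX.
rewrite (_ : Y t - Phi Y t = (Y t - X k.+1 t) - (Phi Y t - X k.+1 t)); last first.
  by rewrite opprB addrA subrK.
rewrite (le_trans (ler_normB _ _))// (le_trans (lerD YX ZX))//.
rewrite (_ : _ + _ = 2 * (C * E t) / 2 ^+ k); last first.
  by rewrite exprS; field; rewrite expf_neq0.
rewrite ler_pM2r ?invr_gt0 ?exprn_gt0//.
by apply: ler_wpM2r; [exact: mulr_ge0|rewrite ler_nat].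
Qed.

(** * Quadratic forms and the Rayleigh bound *)

(** The Euclidean product, written as a matrix product so that bilinearity and transposition rules
    come from matrix algebra. *)
Definition dot (R : realType) (n : nat) (x y : 'rV[R]_n) : R := (x *m y^T) 0 0.

Section Dot.
Variables (R : realType) (n : nat).
Implicit Types (x y z : 'rV[R]_n) (A B : 'M[R]_n) (a : R).

Lemma dotE x y : dot x y = \sum_i x 0 i * y 0 i.
Proof. by rewrite /dot mxE; apply: eq_bigr => i _; rewrite mxE. Qed.

Lemma dotC x y : dot x y = dot y x.
Proof. by rewrite !dotE; apply: eq_bigr => i _; rewrite mulrC. Qed.

Lemma dotDl x y z : dot (x + y) z = dot x z + dot y z.
Proof. by rewrite /dot mulmxDl mxE. Qed.

Lemma dotZl a x y : dot (a *: x) y = a * dot x y.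
Proof. by rewrite /dot -scalemxAl mxE. Qed.

Lemma dotBl x y z : dot (x - y) z = dot x z - dot y z.
Proof. by rewrite dotDl -scaleN1r dotZl mulN1r. Qed.

Lemma dotDr x y z : dot x (y + z) = dot x y + dot x z.
Proof. by rewrite dotC dotDl !(dotC x). Qed.

Lemma dotZr a x y : dot x (a *: y) = a * dot x y.
Proof. by rewrite dotC dotZl dotC. Qed.

Lemma dotBr x y z : dot x (y - z) = dot x y - dot x z.
Proof. by rewrite dotC dotBl !(dotC x). Qed.

Lemma dot0l x : dot 0 x = 0.
Proof. by rewrite -(scale0r x) dotZl mul0r. Qed.

Lemma dot_mulmx A x y : dot (x *m A) y = dot x (y *m A^T).
Proof. by rewrite /dot trmx_mul trmxK mulmxA. Qed.

Lemma dot_ge0 x : 0 <= dot x x.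
Proof. by rewrite dotE sumr_ge0// => i _; rewrite -expr2 sqr_ge0. Qed.

(** With [dot_le_sqr_norm], this compares the Euclidean norm, used for Lyapunov functions, with the
    sup norm, used for stability. *)
Lemma sqr_norm_le_dot x : `|x| ^+ 2 <= dot x x.
Proof.
rewrite -(@ler_sqrt R) ?dot_ge0// sqrtr_sqr normr_id.
apply: norm_row_le => [|i]; first exact: sqrtr_ge0.
rewrite -sqrtr_sqr ler_sqrt ?dot_ge0// dotE (bigD1 i)//= -expr2 lerDl.
by rewrite sumr_ge0// => j _; rewrite -expr2 sqr_ge0.
Qed.

Lemma dot_le_norm x y : `|dot x y| <= n%:R * `|x| * `|y|.
Proof.
rewrite dotE (le_trans (ler_norm_sum _ _ _))//.
apply: (@le_trans _ _ (\sum_(i < n) `|x| * `|y|)).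
  by apply: ler_sum => i _; rewrite normrM ler_pM// coord_norm_le.
by rewrite sumr_const card_ord -mulrA mulr_natl.
Qed.

Lemma dot_gt0 x : x != 0 -> 0 < dot x x.
Proof.
by move=> x0; rewrite (lt_le_trans _ (sqr_norm_le_dot x))// exprn_gt0// normr_gt0.
Qed.

Lemma dot_le_sqr_norm x : dot x x <= n%:R * `|x| ^+ 2.
Proof.
by rewrite (le_trans (ler_norm _))// (le_trans (dot_le_norm _ _))// expr2 mulrA.
Qed.

Lemma mulmx_norm_le B : exists2 k, 0 < k & forall x, `|x *m B| <= k * `|x|.
Proof.
have S0 : 0 <= \sum_i \sum_j `|B i j| by apply: sumr_ge0 => i _; exact: sumr_ge0.
exists (1 + \sum_i \sum_j `|B i j|); first by rewrite ltr_pwDl.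
move=> x; apply: norm_row_le => [|j].
  by rewrite mulr_ge0// addr_ge0.
rewrite mxE (le_trans (ler_norm_sum _ _ _))//.
rewrite mulrDl mul1r ler_wpDl// mulr_suml; apply: ler_sum => i _.
rewrite normrM mulrC ler_pM// ?coord_norm_le//.
by rewrite (bigD1 j)//= lerDl sumr_ge0.
Qed.

Lemma quadratic_le B : exists2 k, 0 < k & forall x, dot (x *m B) x <= k * dot x x.
Proof.
have [k k0 kB] := mulmx_norm_le B.
exists (n%:R * k + 1) => [|x]; first by rewrite ltr_wpDl// mulr_ge0// ltW.
rewrite mulrDl mul1r ler_wpDr ?dot_ge0//.
rewrite (le_trans (ler_norm _))// (le_trans (dot_le_norm _ _))//.
rewrite -!mulrA ler_wpM2l// (le_trans (ler_wpM2r _ (kB x)))// -mulrA ler_pM2l//.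
by rewrite -expr2 sqr_norm_le_dot.
Qed.

(* Expand [0 <= q (x - t y)] at [y = x B^-1], where [q y] is bounded by a
   multiple of [dot x x], for a small fixed [t]. *)
Lemma coercive_of_unit B : B^T = B -> B \in unitmx ->
  (forall x, 0 <= dot (x *m B) x) ->
  exists2 c, 0 < c & forall x, c * dot x x <= dot (x *m B) x.
Proof.
move=> BT uB B0; have [k k0 kB] := quadratic_le (invmx B).
(* With [a] and [q] as named below and [d = dot x x], the expansion reads 0 <= q - 2 t d + t^2 a. As
   a <= k d and t k <= 1, this gives q >= t d. *)
pose t := (k + 1)^-1.
have k10 : 0 < k + 1 by rewrite addr_gt0.
have t0 : 0 < t by rewrite invr_gt0.
exists t => // x; have := B0 (x - t *: (x *m invmx B)).
rewrite mulmxBl -scalemxAl mulmxKV// !dotBl !dotBr !dotZl !dotZr.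
rewrite [dot (x *m B) (x *m _)]dot_mulmx BT mulmxKV//.
rewrite [dot x (x *m _)]dotC; have := kB x.
set a := dot (x *m invmx B) x; set q := dot (x *m B) x; set d := dot x x.
move=> akd H.
have tk : t * k <= 1.
  by rewrite mulrC ler_pdivrMr// mul1r lerDl.
have d0 : 0 <= d by exact: dot_ge0.
have : t * (t * a) <= t * d.
  rewrite ler_pM2l// (le_trans (ler_wpM2l (ltW t0) akd))// mulrA.
  by rewrite ler_piMl.
lra.
Qed.

End Dot.

(** [mu] is the least constant in the bound. If [mu *: D - A] were invertible, its form would be
    coercive and [mu] could be lowered; hence it is singular, and a kernel vector gives [w]. *)
Lemma rayleigh (R : realType) (n : nat) (A D : 'M[R]_n) (d : R) :
  (0 < n)%N -> A^T = A -> D^T = D -> 0 < d ->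
  (forall x : 'rV[R]_n, d * dot x x <= dot (x *m D) x) ->
  exists mu, (forall x : 'rV[R]_n, dot (x *m A) x <= mu * dot (x *m D) x) /\
    exists2 w : 'rV[R]_n, w != 0 & w *m A = mu *: (w *m D).
Proof.
move=> n0 AT DT d0 dD.
have D0 (x : 'rV[R]_n) : 0 <= dot (x *m D) x.
  by rewrite (le_trans _ (dD x))// mulr_ge0 ?dot_ge0// ltW.
have Dgt0 (x : 'rV[R]_n) : x != 0 -> 0 < dot (x *m D) x.
  by move=> x0; rewrite (lt_le_trans _ (dD x))// mulr_gt0// dot_gt0.
pose S := [set m : R | forall x : 'rV[R]_n, dot (x *m A) x <= m * dot (x *m D) x].
pose one : 'rV[R]_n := const_mx 1.
have one0 : one != 0.
  by apply/eqP => /rowP /(_ (Ordinal n0)) /eqP; rewrite !mxE oner_eq0.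
have S0 : S !=set0.
  have [k k0 kA] := quadratic_le A; exists (k / d) => x /=.
  rewrite (le_trans (kA x))// -mulrA ler_pM2l// mulrC ler_pdivlMr// mulrC.
  exact: dD.
have lbS (x : 'rV[R]_n) : x != 0 -> lbound S (dot (x *m A) x / dot (x *m D) x).
  by move=> x0 m Sm; rewrite ler_pdivrMr ?Dgt0// Sm.
have hS : has_inf S by split=> //; eexists; exact: lbS one0.
exists (inf S); have Sinf : S (inf S).
  move=> x; have [->|x0] := eqVneq x 0; first by rewrite !mul0mx !dot0l mulr0.
  by rewrite -ler_pdivrMr ?Dgt0//; apply: lb_le_inf => //; exact: lbS.
split=> //.
pose N := inf S *: D - A.
have NT : N^T = N by rewrite /N linearB/= linearZ/= AT DT.
have NE (x : 'rV[R]_n) : dot (x *m N) x = inf S * dot (x *m D) x - dot (x *m A) x.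
  by rewrite mulmxBr -scalemxAr dotBl dotZl.
have [uN|] := boolP (N \in unitmx).
  have N0 (x : 'rV[R]_n) : 0 <= dot (x *m N) x by rewrite NE subr_ge0; exact: Sinf.
  have [c c0 cN] := coercive_of_unit NT uN N0.
  have [k k0 kD] := quadratic_le D.
  (* Since [dot (x *m D) x <= k * dot x x], coercivity with constant [c] leaves room for lowering
     [inf S] by [c / k]. *)
  have : S (inf S - c / k).
    move=> x /=; have := cN x; rewrite NE mulrBl => H.
    have : c / k * dot (x *m D) x <= c * dot x x.
      by rewrite -mulrA ler_pM2l// mulrC ler_pdivrMr// mulrC.
    by move: H; lra.
  move=> /(ge_inf hS.2); rewrite lerBrDl gerDr leNgt => /negP; case.
  by rewrite divr_gt0.
rewrite unitmxE unitfE negbK => /det0P[w w0 wN]; exists w => //.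
by move: wN; rewrite mulmxBr -scalemxAr => /eqP; rewrite subr_eq0 => /eqP.
Qed.

(** Identifies the constant of [rayleigh]. Eigenvectors being rows, [w *m D] is one of
    [invmx D *m A]; conversely, the bound at [v *m invmx D] shows that no eigenvalue exceeds
    [mu]. *)
Lemma lambda_max_rayleigh (R : realType) (n : nat) (A D : 'M[R]_n) (d : R) :
  (0 < n)%N -> A^T = A -> D^T = D -> 0 < d ->
  (forall x : 'rV[R]_n, d * dot x x <= dot (x *m D) x) ->
  (forall x : 'rV[R]_n, dot (x *m A) x <= lambda_max (invmx D *m A) * dot (x *m D) x) /\
  exists2 w : 'rV[R]_n, w != 0 & w *m A = lambda_max (invmx D *m A) *: (w *m D).
Proof.
move=> n0 AT DT d0 dD.
have [mu [muA [w w0 wA]]] := rayleigh n0 AT DT d0 dD.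
have uD : D \in unitmx.
  rewrite unitmxE unitfE; apply/negP => /det0P[v v0 vD].
  by have := dD v; rewrite vD dot0l leNgt mulr_gt0// dot_gt0.
suff -> : lambda_max (invmx D *m A) = mu by split=> //; exists w.
have eig : [set a | eigenvalue (invmx D *m A) a] mu.
  apply/eigenvalueP; exists (w *m D).
    by rewrite mulmxA mulmxK.
  by apply: contra_neq w0 => wD; rewrite -(mulmxK uD w) wD mul0mx.
have ub : ubound [set a | eigenvalue (invmx D *m A) a] mu.
  move=> a /eigenvalueP[v vA v0]; pose u := v *m invmx D.
  have uA : u *m A = a *: (u *m D) by rewrite /u mulmxKV// -mulmxA.
  have u0 : u != 0.
    by apply: contra_neq v0 => u0; rewrite -(mulmxKV uD v) -/u u0 mul0mx.
  have := muA u; rewrite uA dotZl ler_pM2r//.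
  by rewrite (lt_le_trans _ (dD u))// mulr_gt0// dot_gt0.
apply/eqP; rewrite eq_le; apply/andP; split.
  by apply: ge_sup => //; exists mu.
by apply: ub_le_sup => //; exists mu.
Qed.

(** * Sigmoids *)

Section Sigmoid.
Variables (R : realType) (f : R -> R).
Hypothesis f_sig : sigmoid f.

Let is_derive_f (s : R) : is_derive s 1 f (derive1 f s).
Proof. by rewrite derive1E; exact/derivableP/(@sigmoid_derivable _ _ f_sig). Qed.

Let continuous_f : continuous f.
Proof.
move=> s; apply: differentiable_continuous; apply/derivable1_diffP.
exact: sigmoid_derivable.
Qed.

Lemma sigmoid0 : f 0 = 0.
Proof. by have := sigmoid_odd f_sig 0; rewrite oppr0; lra. Qed.

Lemma sigmoid_le (x y : R) : x <= y -> f x <= f y.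
Proof.
rewrite le_eqVlt => /predU1P[->//|xy].
have [||c _ fE] := @MVT R f (derive1 f) x y xy.
- by move=> s _; exact: is_derive_f.
- exact: continuous_subspaceT.
by rewrite -subr_ge0 fE mulr_ge0// ltW// ?subr_gt0// sigmoid_derive_gt0.
Qed.

(** By monotonicity, a value above 1 would bound [f] from below at all larger arguments, against the
    limit 1. *)
Lemma sigmoid_le1 (s : R) : f s <= 1.
Proof.
rewrite leNgt; apply/negP => fs.
have : \forall t \near +oo, f t < f s.
  exact: (cvgr_lt _ (sigmoid_pinfty f_sig)).
move=> /(filterI (nbhs_pinfty_ge (num_real s)))/filter_ex[t [st]].
by rewrite ltNge sigmoid_le.
Qed.

Lemma sigmoid_norm_le1 (s : R) : `|f s| <= 1.
Proof.
by rewrite ler_norml sigmoid_le1 lerNl -(sigmoid_odd f_sig) sigmoid_le1.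
Qed.

Lemma sigmoid_near0 (e : R) : 0 < e ->
  exists2 r, 0 < r & forall s, `|s| < r -> `|f s - s| <= e * `|s|.
Proof.
move=> e0; have [df0 _] := is_derive_f 0.
have : h^-1 *: (f (h *: 1 + 0) - f 0) @[h --> 0^'] --> derive1 f 0.
  by rewrite derive1E; exact: df0.
rewrite (sigmoid_derive0 f_sig) => /cvgrPdist_le /(_ e e0) /nbhs_ballP.
move=> [r /= r0 rP]; exists r => // s sr.
have [->|s0] := eqVneq s 0; first by rewrite sigmoid0 subrr normr0 mulr0.
have := rP s; rewrite /ball/= sub0r normrN => /(_ sr s0).
rewrite sigmoid0 subr0 addr0 /GRing.scale/= mulr1 => H.
have -> : f s - s = - ((1 - s^-1 * f s) * s) by field.
by rewrite normrN normrM ler_wpM2r.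
Qed.

(** Slopes of consecutive chords decrease, by concavity; the inequality is cross-multiplied. *)
Let chord_le (x y z : R) : 0 < x -> x < y -> y < z ->
  (f z - f y) * (y - x) <= (f y - f x) * (z - y).
Proof.
move=> x0 xy yz; pose t := (z - y) / (z - x).
have zx : 0 < z - x by rewrite subr_gt0 (lt_trans xy).
have z0 : 0 < z by rewrite (lt_trans x0)// (lt_trans xy).
have xz : x != z by rewrite lt_eqF// (lt_trans xy).
have t0 : 0 < t by rewrite divr_gt0// subr_gt0.
have t1 : t < 1 by rewrite ltr_pdivrMr// mul1r; lra.
have := sigmoid_concave f_sig x0 z0 xz t0 t1.
rewrite (_ : t * x + (1 - t) * z = y); last by rewrite /t; field; rewrite gt_eqF.
rewrite -(ltr_pM2r zx).
rewrite (_ : (t * f x + _) * _ = (z - y) * f x + (y - x) * f z); last first.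
  by rewrite /t; field; rewrite gt_eqF.
by lra.
Qed.

(* By concavity the slope of [f] on [[x, y]] is at most its slope on
   [[w / 2, w]], which is at most 4 by [sigmoid_near0]. *)
Let slope_le (x y : R) : 0 < x -> x < y -> f y - f x <= 4 * (y - x).
Proof.
move=> x0 xy; have [r r0 rP] := sigmoid_near0 ltr01.
pose w := Num.min (x / 2) (r / 2).
have w0 : 0 < w by rewrite lt_min !divr_gt0.
have wx : w < x by rewrite gt_min; apply/orP; left; lra.
have wr : w < r by rewrite gt_min; apply/orP; right; lra.
have w2 : w / 2 < w by lra.
have w20 : 0 < w / 2 by lra.
have fw : f w <= 2 * w.
  have := rP w; rewrite gtr0_norm// mul1r => /(_ wr).
  by rewrite ler_norml => /andP[_]; lra.
have fw2 : 0 <= f (w / 2).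
  have := rP (w / 2); rewrite gtr0_norm// mul1r => /(_ (lt_trans w2 wr)).
  by rewrite ler_norml => /andP[+ _]; lra.
have h1 := chord_le w20 w2 wx.
have h2 := chord_le w0 wx xy.
have xw : 0 < x - w by rewrite subr_gt0.
have yx : 0 < y - x by rewrite subr_gt0.
have h3 : f x - f w <= 4 * (x - w).
  have h0 : (f w - f (w / 2)) * (x - w) <= 2 * w * (x - w).
    by rewrite ler_wpM2r; lra.
  by rewrite -(ler_pM2r w20); lra.
rewrite -(ler_pM2r xw) (le_trans h2)// mulrAC.
by rewrite ler_pM2r.
Qed.

(** Concavity is given on positive arguments only, so the chord from 0 is cut at a small [w] where
    [f w <= 2 * w]. *)
Let slope0_le (y : R) : 0 <= y -> f y <= 4 * y.
Proof.
rewrite le_eqVlt => /predU1P[<-|y0]; first by rewrite sigmoid0 mulr0.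
have [r r0 rP] := sigmoid_near0 ltr01.
pose w := Num.min (y / 2) (r / 2).
have w0 : 0 < w by rewrite lt_min !divr_gt0.
have wy : w < y by rewrite gt_min; apply/orP; left; lra.
have wr : w < r by rewrite gt_min; apply/orP; right; lra.
have := slope_le w0 wy.
have := rP w; rewrite gtr0_norm// mul1r => /(_ wr).
by rewrite ler_norml => /andP[_]; lra.
Qed.

(** Oddness carries the bound to negative arguments, and an interval containing 0 is cut at 0. *)
Lemma sigmoid_lipschitz (x y : R) : `|f x - f y| <= 4 * `|x - y|.
Proof.
wlog xy : x y / x <= y.
  move=> H; have [/H//|/ltW/H] := leP x y.
  by rewrite distrC (distrC y).
rewrite distrC (distrC x) !ger0_norm ?subr_ge0 ?sigmoid_le//.
have [x0|x0] := ltP 0 x.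
  by move: xy; rewrite le_eqVlt => /predU1P[->|/slope_le->//]; rewrite !subrr mulr0.
have fN (z : R) : f z = - f (- z) by rewrite (sigmoid_odd f_sig) opprK.
have [y0|y0] := leP 0 y.
  have := slope0_le y0; have := @slope0_le (- x).
  by rewrite oppr_ge0 (fN x) => /(_ x0); lra.
move: xy; rewrite le_eqVlt => /predU1P[->|xy]; first by rewrite !subrr mulr0.
have := @slope_le (- y) (- x); rewrite oppr_gt0 ltrN2 => /(_ y0 xy).
by rewrite (fN x) (fN y); lra.
Qed.

End Sigmoid.

(** * The opinion field *)

Lemma exists_lt_family (R : realType) (I : finType) (r : I -> R) :
  (forall i, 0 < r i) -> exists2 d, 0 < d & forall i, d < r i.
Proof.
move=> r0; have : \forall d \near 0^'+, forall i, d < r i.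
  by apply: filter_forall => i; exact: nbhs_right_lt.
move=> /(filterI (nbhs_right_gt 0))/filter_ex[d [d0 dr]].
by exists d.
Qed.

Section Field.
Variables (R : realType) (n : nat) (A2 : 'M[R]_n) (A3 : 'I_n -> 'M[R]_n).
Variables (psi : 'I_n -> R -> R) (p : R).
Hypothesis A2_ge0 : forall i j : 'I_n, 0 <= A2 i j.
Hypothesis A2_sym : A2^T = A2.
Hypothesis A3_ge0 : forall i j k : 'I_n, 0 <= A3 i j k.
Hypothesis degree_gt0 : forall i : 'I_n, 0 < degree A2 A3 i.
Hypothesis psi_sigmoid : forall i : 'I_n, sigmoid (psi i).
Hypothesis p_gt0 : 0 < p.

Let F := opinion_field A2 A3 psi p.
Let M := p *: A2 - degree_mx A2 A3.

(** The nonnegative weights of agent [i] add up to its degree. Both the Lipschitz bound and the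
    linearization reduce to bounding the weighted terms. *)
Let weighted_le (i : 'I_n) (u : 'I_n -> R) (v : 'I_n -> 'I_n -> R) (b : R) :
  (forall j, `|u j| <= b) -> (forall j k, `|v j k| <= b) ->
  `|p * (\sum_j A2 i j * u j) + p * (\sum_j \sum_k A3 i j k * v j k)|
    <= p * degree A2 A3 i * b.
Proof.
move=> ub vb; rewrite -mulrDr normrM gtr0_norm// -mulrA ler_pM2l//.
rewrite /degree mulrDl (le_trans (ler_normD _ _))// lerD//.
  rewrite (le_trans (ler_norm_sum _ _ _))// mulr_suml; apply: ler_sum => j _.
  by rewrite normrM ger0_norm// ler_wpM2l.
rewrite (le_trans (ler_norm_sum _ _ _))// mulr_suml; apply: ler_sum => j _.
rewrite (le_trans (ler_norm_sum _ _ _))// mulr_suml; apply: ler_sum => k _.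
by rewrite normrM ger0_norm// ler_wpM2l.
Qed.

Let deg : R := \sum_i degree A2 A3 i.

Let degree_le (i : 'I_n) : degree A2 A3 i <= deg.
Proof. by rewrite /deg (bigD1 i)//= lerDl sumr_ge0// => j _; exact: ltW. Qed.

Let deg_ge0 : 0 <= deg.
Proof. by apply: sumr_ge0 => i _; exact: ltW. Qed.

Lemma opinion_field_lipschitz :
  exists2 L, 0 < L & forall x y, `|F x - F y| <= L * `|x - y|.
Proof.
(* The 1 inside is for the linear term, 8 = 4 + 4 for a difference of products of two factors
   bounded by 1 and 4-Lipschitz; the last 1 ensures [0 < L]. *)
pose L := (1 + p * 8) * deg + 1.
have L0 : 0 < L by rewrite ltr_wpDl// mulr_ge0// addr_ge0// mulr_ge0// ltW.
exists L => // x y.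
have xy i : `|x 0 i - y 0 i| <= `|x - y|.
  by have := coord_norm_le (x - y) i; rewrite !mxE.
have psixy i : `|psi i (x 0 i) - psi i (y 0 i)| <= 4 * `|x - y|.
  by rewrite (le_trans (sigmoid_lipschitz (psi_sigmoid i) _ _))// ler_pM2l.
apply: norm_row_le => [|i]; first by rewrite mulr_ge0// ltW.
rewrite !mxE.
set X2 := \sum_j A2 i j * psi j (x 0 j).
set Y2 := \sum_j A2 i j * psi j (y 0 j).
set X3 := \sum_j \sum_k A3 i j k * psi j (x 0 j) * psi k (x 0 k).
set Y3 := \sum_j \sum_k A3 i j k * psi j (y 0 j) * psi k (y 0 k).
have -> : - degree A2 A3 i * x 0 i + p * X2 + p * X3
    - (- degree A2 A3 i * y 0 i + p * Y2 + p * Y3) =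
    - (degree A2 A3 i * (x 0 i - y 0 i)) +
    (p * (\sum_j A2 i j * (psi j (x 0 j) - psi j (y 0 j))) +
     p * (\sum_j \sum_k A3 i j k *
       (psi j (x 0 j) * psi k (x 0 k) - psi j (y 0 j) * psi k (y 0 k)))).
  have -> : \sum_j A2 i j * (psi j (x 0 j) - psi j (y 0 j)) = X2 - Y2.
    by rewrite -sumrB; apply: eq_bigr => j _; rewrite mulrBr.
  have -> : \sum_j \sum_k A3 i j k * (psi j (x 0 j) * psi k (x 0 k)
      - psi j (y 0 j) * psi k (y 0 k)) = X3 - Y3.
    rewrite -sumrB; apply: eq_bigr => j _; rewrite -sumrB.
    by apply: eq_bigr => k _; rewrite mulrBr !mulrA.
  by ring.
rewrite (le_trans (ler_normD _ _))// normrN normrM gtr0_norm//.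
have H : `|p * (\sum_j A2 i j * (psi j (x 0 j) - psi j (y 0 j))) +
     p * (\sum_j \sum_k A3 i j k *
       (psi j (x 0 j) * psi k (x 0 k) - psi j (y 0 j) * psi k (y 0 k)))|
    <= p * degree A2 A3 i * (8 * `|x - y|).
  apply: weighted_le => [j|j k].
    by rewrite (le_trans (psixy j))// ler_wpM2r// ler_nat.
  rewrite (_ : _ - _ = psi j (x 0 j) * (psi k (x 0 k) - psi k (y 0 k))
    + (psi j (x 0 j) - psi j (y 0 j)) * psi k (y 0 k)); last by ring.
  rewrite (le_trans (ler_normD _ _))// !normrM.
  have H1 := ler_pM (normr_ge0 _) (normr_ge0 _)
    (sigmoid_norm_le1 (psi_sigmoid j) (x 0 j)) (psixy k).
  have H2 := ler_pM (normr_ge0 _) (normr_ge0 _)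
    (psixy j) (sigmoid_norm_le1 (psi_sigmoid k) (y 0 k)).
  by move: H1 H2; rewrite mul1r mulr1; lra.
have H' : degree A2 A3 i * `|x 0 i - y 0 i| <= degree A2 A3 i * `|x - y|.
  by rewrite ler_pM2l.
rewrite (le_trans (lerD H' H))//.
have -> : degree A2 A3 i * `|x - y| + p * degree A2 A3 i * (8 * `|x - y|) =
  (1 + p * 8) * degree A2 A3 i * `|x - y| by ring.
rewrite ler_wpM2r// /L ler_wpDr// ler_pM2l// addr_gt0// mulr_gt0//.
Qed.

Lemma opinion_field_linearization (e : R) : 0 < e ->
  exists2 r, 0 < r & forall x, `|x| < r -> `|F x - x *m M| <= e * `|x|.
Proof.
move=> e0; pose b := e / (p * deg + 1).
have pd0 : 0 < p * deg + 1 by rewrite ltr_wpDl// mulr_ge0// ltW.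
have b0 : 0 < b by rewrite divr_gt0.
have /choice[r1 r1P] : forall i, exists r, 0 < r /\
    forall s, `|s| < r -> `|psi i s - s| <= b * `|s|.
  by move=> i; have [r] := sigmoid_near0 (psi_sigmoid i) b0; exists r.
have [r r0 rr1] := exists_lt_family (fun i => (r1P i).1).
(* The products in the [A3] sum are at most (4 |x|)^2 = 16 |x|^2, hence at most b |x| in this
   ball. *)
exists (Num.min r (b / 16)); first by rewrite lt_min r0 divr_gt0.
move=> x; rewrite lt_min => /andP[xr xb].
apply: norm_row_le => [|i]; first by rewrite mulr_ge0// ltW.
(* The degree terms cancel; symmetry of [A2] matches the row product [x *m A2] with the sums in the
   field. *)
have -> : (F x - x *m M) 0 i =
    p * (\sum_j A2 i j * (psi j (x 0 j) - x 0 j)) +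
    p * (\sum_j \sum_k A3 i j k * (psi j (x 0 j) * psi k (x 0 k))).
  rewrite mulmxBr -scalemxAr mul_mx_diag !mxE.
  have -> : \sum_j x 0 j * A2 j i = \sum_j A2 i j * x 0 j.
    by apply: eq_bigr => j _; rewrite -{1}A2_sym mxE mulrC.
  have -> : \sum_j A2 i j * (psi j (x 0 j) - x 0 j) =
      \sum_j A2 i j * psi j (x 0 j) - \sum_j A2 i j * x 0 j.
    by rewrite -sumrB; apply: eq_bigr => j _; rewrite mulrBr.
  have -> : \sum_j \sum_k A3 i j k * (psi j (x 0 j) * psi k (x 0 k)) =
      \sum_j \sum_k A3 i j k * psi j (x 0 j) * psi k (x 0 k).
    by apply: eq_bigr => j _; apply: eq_bigr => k _; rewrite mulrA.
  by ring.
have psix j : `|psi j (x 0 j)| <= 4 * `|x|.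
  have := sigmoid_lipschitz (psi_sigmoid j) (x 0 j) 0.
  rewrite sigmoid0// !subr0 => /le_trans; apply.
  by rewrite ler_pM2l// coord_norm_le.
have -> : e * `|x| = (p * deg + 1) * (b * `|x|).
  by rewrite /b; field; rewrite gt_eqF.
apply: (@le_trans _ _ (p * degree A2 A3 i * (b * `|x|))).
  apply: weighted_le => [j|j k].
    have [_ /(_ (x 0 j))] := r1P j.
    move=> /(_ (le_lt_trans (coord_norm_le x j) (lt_trans xr (rr1 j)))).
    by move=> /le_trans; apply; rewrite ler_pM2l// coord_norm_le.
  rewrite normrM (le_trans (ler_pM (normr_ge0 _) (normr_ge0 _) (psix j) (psix k)))//.
  rewrite (_ : 4 * `|x| * (4 * `|x|) = 16 * `|x| * `|x|); last by ring.
  by rewrite ler_wpM2r//; lra.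
apply: ler_wpM2r; first by rewrite mulr_ge0// ltW.
by rewrite ler_wpDr// ler_pM2l.
Qed.

Lemma opinion_field0 : F 0 = 0.
Proof.
apply/rowP => i; rewrite !mxE mulr0 !big1 ?mulr0 ?addr0// => j _.
  by rewrite big1// => k _; rewrite mxE sigmoid0// mulr0 mul0r.
by rewrite mxE sigmoid0// mulr0.
Qed.

End Field.

Lemma degree_mx_coercive (R : realType) (n : nat) (A2 : 'M[R]_n)
    (A3 : 'I_n -> 'M[R]_n) :
  (forall i : 'I_n, 0 < degree A2 A3 i) ->
  exists2 d, 0 < d & forall x, d * dot x x <= dot (x *m degree_mx A2 A3) x.
Proof.
move=> deg0; have [d d0 dP] := exists_lt_family deg0.
exists d => // x; rewrite !dotE mulr_sumr; apply: ler_sum => i _.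
rewrite mul_mx_diag !mxE mulrAC -!expr2 [leRHS]mulrC.
by rewrite ler_wpM2r ?sqr_ge0// ltW.
Qed.

(** * Stability and instability from the linear part *)

Section Dynamics.
Variables (R : realType) (n : nat).
Implicit Types (B M : 'M[R]_n) (F : 'rV[R]_n -> 'rV[R]_n) (x : R -> 'rV[R]_n).

Lemma is_derive_dot (x y : R -> 'rV[R]_n) (dx dy : 'rV[R]_n) (t : R) :
  is_derive t 1 x dx -> is_derive t 1 y dy ->
  is_derive t 1 (fun s => dot (x s) (y s)) (dot dx (y t) + dot (x t) dy).
Proof.
move=> /is_derive_rowP dxi /is_derive_rowP dyi.
have -> : (fun s => dot (x s) (y s)) =
    \sum_(i < n) ((fun s => x s 0 i) * (fun s => y s 0 i)).
  by apply/funext => s; rewrite dotE fct_sumE.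
have -> : dot dx (y t) + dot (x t) dy =
    \sum_(i < n) (x t 0 i *: dy 0 i + y t 0 i *: dx 0 i).
  rewrite !dotE -big_split/=; apply: eq_bigr => i _.
  by rewrite /GRing.scale/= addrC (mulrC (dx 0 i)).
by apply: is_derive_sum => i; exact: is_deriveM.
Qed.

Lemma is_derive_mulmxr B x (dx : 'rV[R]_n) (t : R) :
  is_derive t 1 x dx -> is_derive t 1 (fun s => x s *m B) (dx *m B).
Proof.
move=> /is_derive_rowP dxi; apply/is_derive_rowP => j.
have -> : (fun s => (x s *m B) 0 j) =
    \sum_(i < n) (B i j \*: (fun s => x s 0 i)).
  by apply/funext => s; rewrite mxE fct_sumE; apply: eq_bigr => i _; rewrite mulrC.
have -> : (dx *m B) 0 j = \sum_(i < n) (B i j *: dx 0 i).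
  by rewrite mxE; apply: eq_bigr => i _; rewrite mulrC.
by apply: is_derive_sum => i; exact: is_deriveZ.
Qed.

Lemma is_derive_quadratic B F x (t : R) : B^T = B -> solution F x -> 0 < t ->
  is_derive t 1 (fun s => dot (x s *m B) (x s)) (2 * dot (x t *m B) (F (x t))).
Proof.
move=> BT [_ dx] t0; have dxt := dx t t0.
have -> : 2 * dot (x t *m B) (F (x t)) =
    dot (F (x t) *m B) (x t) + dot (x t *m B) (F (x t)).
  by rewrite dot_mulmx BT dotC mulr_natl mulr2n.
by apply: is_derive_dot => //; exact: is_derive_mulmxr.
Qed.

(** The domain is an arbitrary topological space so as to include the half-line with its subspace
    topology. *)
Lemma continuous_quadratic (T : topologicalType) B (u : T -> 'rV[R]_n) :
  (forall i, continuous (fun t => u t 0 i)) ->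
  continuous (fun t => dot (u t *m B) (u t)).
Proof.
move=> cu; have -> : (fun t => dot (u t *m B) (u t)) =
    (fun t => \sum_j (\sum_i u t 0 i * B i j) * u t 0 j).
  by apply/funext => t; rewrite dotE; apply: eq_bigr => j _; rewrite mxE.
move=> t; apply: cvg_big => [|j _]; first exact: add_continuous.
apply: cvgM; last exact: cu.
apply: cvg_big => [|i _]; first exact: add_continuous.
by apply: cvgMr_tmp; exact: cu.
Qed.

Lemma solution_quadratic_continuous B F x : solution F x ->
  {within [set t : R | 0 <= t], continuous (fun t => dot (x t *m B) (x t))}.
Proof.
by move=> [cx _]; apply: continuous_quadratic => i; exact: continuous_coord.
Qed.

(* [V = dot x x] is nonincreasing as long as [x] stays in the ball of radius
   [r], hence never leaves its sublevel sets; if [V] stayed above [e ^ 2] it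
   would decrease at a rate bounded away from [0]. *)
Lemma lyapunov_asymptotically_stable F (c r L : R) :
  0 < c -> 0 < r -> 0 < L ->
  (forall u v, `|F u - F v| <= L * `|u - v|) ->
  (forall v, `|v| < r -> dot v (F v) <= - c * dot v v) ->
  locally_asymptotically_stable F 0.
Proof.
move=> c0 r0 L0 FL Fc.
pose V x (t : R) := dot (x t) (x t).
have dV x (t : R) : solution F x -> 0 < t ->
    is_derive t 1 (V x) (2 * dot (x t) (F (x t))).
  move=> sx t0; have := is_derive_quadratic (trmx1 _ _) sx t0.
  rewrite mulmx1 (_ : (fun s => _) = V x)//.
  by apply/funext => s; rewrite mulmx1.
have cV x : solution F x -> {within [set t : R | 0 <= t], continuous (V x)}.
  move=> sx; rewrite (_ : V x = (fun s => dot (x s *m 1%:M) (x s))).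
    exact: solution_quadratic_continuous sx.
  by apply/funext => s; rewrite mulmx1.
have norm_lt (v : 'rV[R]_n) (e : R) : 0 < e -> dot v v < e ^+ 2 -> `|v| < e.
  move=> e0 ve; have := le_lt_trans (sqr_norm_le_dot v) ve.
  by rewrite ltr_pXn2r// nnegrE// ltW.
have stay : forall (x : R -> 'rV[R]_n) (m : R), solution F x -> 0 < m ->
    m <= r -> V x 0 < m ^+ 2 -> forall t : R, 0 <= t -> V x t < m ^+ 2.
  move=> x m sx m0 mr; apply: (trapping (cV x sx) (fun t => dV x t sx)).
  move=> t t0 /(norm_lt _ _ m0) xm.
  rewrite pmulr_rle0// (le_trans (Fc _ (lt_le_trans xm mr)))//.
  by rewrite mulNr oppr_le0 mulr_ge0 ?dot_ge0// ltW.
(* Converts a sup norm ball into a Euclidean one, by n <= (n + 1)^2; the successor keeps the divisor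
   nonzero. *)
have start (v : 'rV[R]_n) (e : R) : 0 < e -> `|v| < e / n.+1%:R ->
    dot v v < e ^+ 2.
  move=> e0 ve; rewrite (le_lt_trans (dot_le_sqr_norm v))//.
  have [->|v0] := eqVneq v 0; first by rewrite normr0 expr0n/= mulr0 exprn_gt0.
  move: ve; rewrite ltr_pdivlMr// => ve.
  apply: (@le_lt_trans _ _ ((`|v| * n.+1%:R) ^+ 2)).
    rewrite exprMn mulrC ler_wpM2l ?exprn_ge0//.
    by rewrite -natrX ler_nat expnS expn1 (leq_trans (leqnSn n))// leq_pmulr.
  by rewrite ltr_pXn2r// nnegrE ?mulr_ge0// ltW.
split.
  move=> e e0; pose m := Num.min e r.
  have m0 : 0 < m by rewrite lt_min e0.
  exists (m / n.+1%:R); split; first by rewrite divr_gt0.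
  move=> x sx; rewrite subr0 => /(start _ _ m0) x0m t t0; rewrite subr0.
  rewrite (@lt_le_trans _ _ m)// ?ge_min ?lexx//.
  by apply: norm_lt => //; apply: stay => //; rewrite ge_min lexx orbT.
exists (r / n.+1%:R); split; first by rewrite divr_gt0.
move=> x0; rewrite subr0 => /(start _ _ r0) x0r; split.
  exact: lipschitz_solution L0 FL.
move=> x sx xx0.
have V0r : V x 0 < r ^+ 2 by rewrite /V xx0.
have dV0 (t : R) : 0 < t -> 2 * dot (x t) (F (x t)) <= - (2 * c * V x t).
  move=> t0; have xr : `|x t| < r by apply: norm_lt => //; apply: stay => //; exact: ltW.
  by have := Fc _ xr; rewrite /V; lra.
have Vge0 t : 0 <= V x t by exact: dot_ge0.
have Vdec (s t : R) : 0 <= s -> s <= t -> V x t <= V x s.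
  move=> s0 st; apply: (@derive_le0_nonincr R (V x)
      (fun t => 2 * dot (x t) (F (x t)))) => //; first exact: cV.
    by move=> u su _; apply: dV => //; exact: le_lt_trans su.
  move=> u su _; rewrite (le_trans (dV0 u _))//; first exact: le_lt_trans su.
  by rewrite oppr_le0 mulr_ge0// mulr_ge0// ltW.
apply/cvgr0Pnorm_lt => e e0.
(* If [e ^+ 2 <= V x t], then by monotonicity the same holds at all earlier times, where V' <= - k.
   So V + k s is nonincreasing up to [t], which forces V < 0 once k t > V 0. *)
pose k := 2 * c * e ^+ 2.
have k0 : 0 < k by rewrite !mulr_gt0// exprn_gt0.
near=> t; apply: norm_lt => //; rewrite ltNge; apply/negP => eV.
have t0 : 0 < t by near: t; exact: (nbhs_pinfty_gt (num_real _)).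
have := @derive_le0_nonincr R (V x + (k \*: id))
  (fun t => 2 * dot (x t) (F (x t)) + k *: 1) 0 t (lexx _) (ltW t0).
have tk : V x 0 < k * t.
  rewrite mulrC -ltr_pdivrMr//; near: t; exact: (nbhs_pinfty_gt (num_real _)).
move=> H; have : V x t + k * t <= V x 0 + k * 0.
  apply: H.
  - apply: within_continuousD; first exact: cV.
    by apply: continuous_subspaceT => s; apply: cvgMr; exact: cvg_id.
  - move=> s s0 _; apply: is_deriveD; [exact: dV|exact: is_deriveZ].
  - move=> s s0 st; rewrite /GRing.scale/= mulr1.
    rewrite -lerBrDr sub0r (le_trans (dV0 s s0))// lerN2 /k.
    rewrite ler_pM2l ?mulr_gt0//.
    by rewrite (le_trans eV)// Vdec// ltW.
by have := Vge0 t; lra.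
Unshelve. all: by end_near. Qed.

(* Chetaev: with [V = dot (x (M - e)) x] and [y = x (M - e)], one has
   [V' = 2 (e V + |y|^2 + dot y h)] where [h = F x - x M], and invertibility
   of [M - e] makes [|y|^2] dominate [dot y h]. *)
Lemma chetaev_unstable F M (L : R) (v : 'rV[R]_n) :
  0 < L -> (forall u w, `|F u - F w| <= L * `|u - w|) ->
  M^T = M -> 0 < dot (v *m M) v ->
  (forall e : R, 0 < e ->
     exists2 r, 0 < r & forall u, `|u| < r -> `|F u - u *m M| <= e * `|u|) ->
  unstable F 0.
Proof.
move=> L0 FL MT vM Flin.
have v0 : v != 0 by apply: contraTneq vM => ->; rewrite mul0mx dot0l ltxx.
have dv0 := dot_gt0 v0.
pose q := dot (v *m M) v / dot v v.
have q0 : 0 < q by rewrite divr_gt0.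
(* The candidates [q / k.+2] are distinct and as many as the size of the characteristic polynomial,
   which exceeds its number of roots. Taking [e < q] keeps the form of [M - e%:M] positive at
   [v]. *)
have [e [e0 eq eM]] : exists e, [/\ 0 < e, e < q & ~~ root (char_poly M) e].
  pose s := [seq q / k.+2%:R | k <- iota 0 (size (char_poly M))].
  have us : uniq s.
    rewrite map_inj_uniq ?iota_uniq// => i j /(mulfI (lt0r_neq0 q0))/invr_inj.
    by move=> /eqP; rewrite eqr_nat => /eqP[].
  have : ~~ all (root (char_poly M)) s.
    apply/negP => rs.
    have := max_poly_roots (monic_neq0 (char_poly_monic M)) rs us.
    by rewrite size_map size_iota ltnn.
  move=> /allPn[e /mapP[k _ ->] eM]; exists (q / k.+2%:R); split=> //.
    by rewrite divr_gt0.
  by rewrite ltr_pdivrMr// ltr_pMr// ltr1n.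
pose N := M - e%:M.
have NT : N^T = N by rewrite /N linearB/= MT tr_scalar_mx.
have NE (x : 'rV[R]_n) : x *m N = x *m M - e *: x.
  by rewrite mulmxBr mul_mx_scalar.
have uN : N \in unitmx.
  rewrite unitmxE unitfE; apply/negP => /det0P[u u0 uN].
  move: eM; rewrite -eigenvalue_root_char => /negP; apply.
  apply/eigenvalueP; exists u => //.
  by move: uN => /eqP; rewrite NE subr_eq0 => /eqP.
have [k k0 kN] := mulmx_norm_le (invmx N).
have nk0 : 0 < n%:R * k + 1 by rewrite ltr_wpDl// mulr_ge0// ltW.
(* For h = F x - x M, this yields |dot y h| <= n |y| eta k |y| <= |y|^2 <= dot y y. *)
pose eta := (n%:R * k + 1)^-1.
have eta0 : 0 < eta by rewrite invr_gt0.
have [r r0 rP] := Flin eta eta0.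
have growth (x : 'rV[R]_n) : `|x| < r ->
    e * dot (x *m N) x <= dot (x *m N) (F x).
  move=> xr; set y := x *m N.
  have xy : `|x| <= k * `|y|.
    by rewrite -[X in `|X|](mulmxK uN) kN.
  have -> : F x = y + e *: x + (F x - x *m M).
    by rewrite /y NE subrK addrC subrK.
  rewrite dotDr (dotDr _ y) dotZr.
  have hy := le_trans (dot_le_norm y (F x - x *m M)) (ler_wpM2l _ (rP x xr)).
  have {}hy : `|dot y (F x - x *m M)| <= dot y y.
    apply: (le_trans (hy _)); first by rewrite mulr_ge0.
    rewrite (le_trans _ (sqr_norm_le_dot y))// expr2.
    rewrite -[leLHS]mulrA mulrCA ler_wpM2l// mulrCA mulrC -/eta.
    rewrite /eta ler_pdivrMr//.
    apply: (@le_trans _ _ (n%:R * (k * `|y|))); first by rewrite ler_wpM2l.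
    by rewrite mulrDr mulr1 ler_wpDr// mulrA mulrC.
  have := ler_norm (- dot y (F x - x *m M)); rewrite normrN.
  by move: hy; lra.
(* Stability is tested at the radius [r] where [growth] holds; the start [c *: v] below has norm
   [d / 2]. *)
move=> /(_ r r0)[d [d0 stab]].
have nv0 : 0 < `|v| by rewrite normr_gt0.
pose c := d / (2 * `|v|).
have c0 : 0 < c by rewrite divr_gt0// mulr_gt0.
have [x [sx x0]] := lipschitz_solution (c *: v) L0 FL.
have xr (t : R) : 0 <= t -> `|x t| < r.
  move=> t0; have := stab x sx; rewrite !subr0 x0 normrZ gtr0_norm// => H.
  have := H _ t t0; rewrite subr0; apply.
  rewrite /c -mulrA invfM -mulrA mulVf ?gt_eqF// mulr1.
  by rewrite ltr_pdivrMr// ltr_pMr// ltr1n.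
pose V (t : R) := dot (x t *m N) (x t).
have V0 : 0 < V 0.
  rewrite /V x0 -scalemxAl dotZl dotZr !(pmulr_rgt0 _ c0) NE dotBl dotZl subr_gt0.
  by rewrite -ltr_pdivlMr.
have [K K0 KN] := quadratic_le N.
have Vbnd (t : R) : 0 <= t -> V t <= K * (n%:R * r ^+ 2).
  move=> t0; rewrite (le_trans (KN _))// ler_pM2l//.
  rewrite (le_trans (dot_le_sqr_norm _))// ler_wpM2l//.
  by rewrite lerXn2r ?nnegrE// ?ltW// xr.
pose a := - (2 * e).
have dV (t : R) : 0 < t -> is_derive t 1 V (2 * dot (x t *m N) (F (x t))).
  exact: is_derive_quadratic NT sx.
have cV : {within [set t : R | 0 <= t], continuous V}.
  exact: solution_quadratic_continuous sx.
(* [V * expR (a * t)] is nondecreasing, since V' >= 2 e V; the monotonicity lemma is applied to its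
   opposite. *)
have Vexp (t : R) : 0 <= t -> V 0 <= V t * expR (a * t).
  move=> t0; have := @derive_le0_nonincr R (- (V * (fun s => expR (a * s))))
    (fun s => - (V s *: (a * expR (a * s)) +
      expR (a * s) *: (2 * dot (x s *m N) (F (x s))))) 0 t (lexx _) t0.
  move=> H; rewrite -lerN2 (le_trans (H _ _ _))//.
  - have cE : {within [set s : R | 0 <= s], continuous (fun s => expR (a * s))}.
      apply: continuous_subspaceT => s; apply: differentiable_continuous.
      by apply/derivable1_diffP; have [] := is_derive_expRM a s.
    move=> s; apply: cvgN; apply: cvgM; last exact: cE.
    exact: cV.
  - move=> s s0 _; apply/is_deriveN/is_deriveM; first exact: dV.
    exact: is_derive_expRM.
  - move=> s s0 _; rewrite oppr_le0 /GRing.scale/=.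
    rewrite (_ : _ + _ = 2 * expR (a * s) *
      (dot (x s *m N) (F (x s)) - e * V s)); last by rewrite /a; ring.
    rewrite mulr_ge0 ?mulr_ge0 ?expR_ge0// subr_ge0.
    exact/growth/xr/ltW.
  - by rewrite !fctE lerN2 mulr0 expR0 mulr1.
pose b := K * (n%:R * r ^+ 2).
have b0 : 0 <= b by rewrite !mulr_ge0 ?exprn_ge0// ltW.
(* At this time the bound 1 + s <= exp s already makes the exponential lower bound at least
   [V 0 + b], while [V] is at most [b]. *)
pose t := b / (2 * e * V 0).
have t0 : 0 <= t by rewrite divr_ge0// !mulr_ge0// ltW.
have : V 0 * expR (2 * e * t) <= b.
  have := Vexp t t0; rewrite /a mulNr expRN ler_pdivlMr ?expR_gt0//.
  by move=> /le_trans; apply; exact: Vbnd.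
have : V 0 * (1 + 2 * e * t) <= V 0 * expR (2 * e * t).
  by rewrite ler_pM2l// expR_ge1Dx.
have -> : V 0 * (1 + 2 * e * t) = V 0 + b.
  by rewrite /t; field; rewrite !gt_eqF.
by lra.
Qed.

End Dynamics.

(** * Sign of the largest eigenvalue and the two regimes of [p] *)

(** A nonnegative matrix with zero sum vanishes, hence is reducible with the identity permutation
    and a first block of size 1, a proper one as [1 < n]. *)
Lemma irreducible_sum_gt0 (R : realType) (n : nat) (A : 'M[R]_n) :
  (1 < n)%N -> irreducible_mx A -> (forall i j, 0 <= A i j) ->
  0 < \sum_i \sum_j A i j.
Proof.
move=> n1 Airr A0; have S0 i : 0 <= \sum_j A i j by exact: sumr_ge0.
rewrite lt_def sumr_ge0// andbT; apply/negP => /eqP Asum0.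
apply: Airr; exists 1%g, 1%N; split=> // i j _ _; rewrite !perm1.
have Ai0 : \sum_j A i j = 0 by apply: (psumr_eq0P _ Asum0) => // k _; exact: S0.
by apply: (psumr_eq0P _ Ai0) => // k _; exact: A0.
Qed.

Theorem lemma1 (R : realType) (n : nat) (hn : (2 <= n)%N)
  (A2 : 'M[R]_n) (A3 : 'I_n -> 'M[R]_n) (psi : 'I_n -> R -> R)
  (A2_ge0 : forall i j : 'I_n, 0 <= A2 i j)
  (A2_sym : A2^T = A2)
  (A2_irr : irreducible_mx A2)
  (A2_diag : forall i : 'I_n, A2 i i = 0)
  (A3_ge0 : forall i j k : 'I_n, 0 <= A3 i j k)
  (degree_gt0 : forall i : 'I_n, 0 < degree A2 A3 i)
  (psi_sigmoid : forall i : 'I_n, sigmoid (psi i))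
  (A3_sym : forall i : 'I_n, A3 i = (A3 i)^T)
  (A3_diag : forall i j : 'I_n, A3 i i j = 0 /\ A3 i j i = 0) :
  (forall p : R, 0 < p -> equilibrium (opinion_field A2 A3 psi p) 0) /\
  (forall p : R, 0 < p -> p < threshold A2 A3 ->
     locally_asymptotically_stable (opinion_field A2 A3 psi p) 0) /\
  (forall p : R, 0 < p -> threshold A2 A3 < p ->
     unstable (opinion_field A2 A3 psi p) 0).
Proof.
have n_gt0 : (0 < n)%N by exact: leq_trans hn.
pose D := degree_mx A2 A3; pose lam := lambda_max (invmx D *m A2).
have DT : D^T = D by exact: tr_diag_mx.
have [d d_gt0 dD] := degree_mx_coercive degree_gt0.
have [lamA [w w0 wA]] := lambda_max_rayleigh n_gt0 A2_sym DT d_gt0 dD.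
rewrite -/D -/lam in lamA wA.
have quadE p (x : 'rV[R]_n) :
    dot (x *m (p *: A2 - D)) x = p * dot (x *m A2) x - dot (x *m D) x.
  by rewrite mulmxBr -scalemxAr dotBl dotZl.
split; [|split] => p p_gt0.
- exact: opinion_field0.
- rewrite /threshold -/D -/lam div1r => p_lt.
  (* Here positivity follows from [0 < p < lam^-1]. *)
  have lam_gt0 : 0 < lam by rewrite -invr_gt0 (lt_trans p_gt0).
  have plam : p * lam < 1 by rewrite -ltr_pdivlMr// div1r.
  pose c := (1 - p * lam) * d.
  have c_gt0 : 0 < c by rewrite mulr_gt0// subr_gt0.
  have neg (x : 'rV[R]_n) : dot (x *m (p *: A2 - D)) x <= - c * dot x x.
    rewrite quadE.
    have := ler_wpM2l (ltW p_gt0) (lamA x).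
    have : 0 <= 1 - p * lam by rewrite subr_ge0 ltW.
    by move=> /ler_wpM2l /(_ _ _ (dD x)); rewrite /c; lra.
  have [L L_gt0 FL] :=
    opinion_field_lipschitz A2_ge0 A3_ge0 degree_gt0 psi_sigmoid p_gt0.
  (* Chosen so that the remainder contributes at most half of the decay rate [c]. *)
  pose e := c / (2 * n%:R).
  have n_gt0R : 0 < n%:R :> R by rewrite ltr0n.
  have e_gt0 : 0 < e by rewrite divr_gt0// mulr_gt0.
  have [r r_gt0 rP] := opinion_field_linearization
    A2_ge0 A2_sym A3_ge0 degree_gt0 psi_sigmoid p_gt0 e_gt0.
  apply: (@lyapunov_asymptotically_stable R n _ (c / 2) r L) => //.
    by rewrite divr_gt0.
  move=> x xr; set F := opinion_field _ _ _ _.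
  have -> : F x = x *m (p *: A2 - D) + (F x - x *m (p *: A2 - D)).
    by rewrite addrC subrK.
  rewrite dotDr [dot x (x *m _)]dotC.
  have h : dot x (F x - x *m (p *: A2 - D)) <= c / 2 * dot x x.
    rewrite (le_trans (ler_norm _))// (le_trans (dot_le_norm _ _))//.
    apply: (@le_trans _ _ (n%:R * `|x| * (e * `|x|))).
      by rewrite ler_wpM2l// ?rP// mulr_ge0.
    have -> : n%:R * `|x| * (e * `|x|) = c / 2 * `|x| ^+ 2.
      by rewrite /e; field; rewrite gt_eqF.
    by rewrite ler_wpM2l ?sqr_norm_le_dot// divr_ge0// ltW.
  by have := neg x; lra.
- rewrite /threshold -/D -/lam div1r => lt_p.
  pose one : 'rV[R]_n := const_mx 1.
  (* To turn [lam^-1 < p] into [1 < p * lam], [lam] must be positive; the all-ones vector shows it,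
     its form being the sum of the entries of [A2]. *)
  have A2_gt0 : 0 < dot (one *m A2) one.
    have -> : dot (one *m A2) one = \sum_j \sum_i A2 i j.
      rewrite dotE; apply: eq_bigr => j _; rewrite !mxE mulr1.
      by apply: eq_bigr => i _; rewrite mxE mul1r.
    by rewrite exchange_big; exact: irreducible_sum_gt0.
  have one0 : one != 0 by apply: contraTneq A2_gt0 => ->; rewrite mul0mx dot0l ltxx.
  have D_gt0 (x : 'rV[R]_n) : x != 0 -> 0 < dot (x *m D) x.
    by move=> x0; rewrite (lt_le_trans _ (dD x))// mulr_gt0// dot_gt0.
  have lam_gt0 : 0 < lam.
    by rewrite -(pmulr_lgt0 _ (D_gt0 _ one0)) (lt_le_trans A2_gt0).
  have plam : 1 < p * lam by rewrite -ltr_pdivrMr// div1r.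
  have [L L_gt0 FL] :=
    opinion_field_lipschitz A2_ge0 A3_ge0 degree_gt0 psi_sigmoid p_gt0.
  (* The eigenvector [w] is a positive direction: its form equals (p lam - 1) w D w^T. *)
  apply: (@chetaev_unstable R n _ (p *: A2 - D) L w) => //.
  + by rewrite linearB/= linearZ/= A2_sym DT.
  + rewrite quadE wA dotZl mulrA subr_gt0 -[ltLHS]mul1r ltr_pM2r//.
    exact: D_gt0.
  + move=> e e_gt0; exact: opinion_field_linearization.
Qed.
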